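(* Let $F$ be the isotropic (ITQ) or anisotropic (ATQ) truncated quadratic functional, assume $F$ is level-bounded, and let $\{x^t\}$ be a sequence generated by the algorithm preDCA$_e$ for minimizing $F$. Let $E(x,y)=F(x)+\frac12\|x-y\|_M^2$ and let $\Upsilon$ be the set of accumulation points of the sequence $(x^t,x^{t-1})$. Then: (i) $\lim_{t\to\infty}\|x^{t+1}-x^t\|_M=0$; (ii) the limit $\zeta:=\lim_{t\to\infty}E(x^t,x^{t-1})$ exists, and $E\equiv\zeta$ on $\Upsilon$.
   Context: Functionals. $X=\mathbb{R}^{m\times n}$ (identified with $\mathbb{R}^{mn}$), $\lambda,\mu>0$, $A:X\to\mathbb{R}^{m_0\times n_0}$ linear, $x_0\in\mathbb{R}^{m_0\times n_0}$. $\nabla=[\nabla_1,\nabla_2]^T$ is the discrete image gradient, $\nabla_1,\nabla_2:X\to X$ linear forward finite differences with homogeneous Neumann boundary condition: $(\nabla_1x)_{i,j}=x_{i+1,j}-x_{i,j}$ if $i<m$ and $0$ if $i=m$; $(\nabla_2x)_{i,j}=x_{i,j+1}-x_{i,j}$ if $j<n$ and $0$ if $j=n$; $|(\nabla x)_{i,j}|=\sqrt{(\nabla_1x)_{i,j}^2+(\nabla_2x)_{i,j}^2}$. (ITQ): $F(x)=\frac12\|Ax-x_0\|_2^2+\sum_{i,j}\frac\mu2\min(|(\nabla x)_{i,j}|^2,\frac\lambda\mu)$. (ATQ): $F(x)=\frac12\|Ax-x_0\|_2^2+\sum_{i,j}\frac\mu2\sum_{l=1}^2\min(|(\nabla_lx)_{i,j}|^2,\frac\lambda\mu)$.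 Set $P_1^I(x)=\sum_{i,j}\frac\mu2(|(\nabla x)_{i,j}|^2+\frac\lambda\mu)$, $P_2^I(x)=\sum_{i,j}\frac\mu2\max(|(\nabla x)_{i,j}|^2,\frac\lambda\mu)$, $P_1^A(x)=\sum_{i,j}\frac\mu2\sum_{l}(|(\nabla_lx)_{i,j}|^2+\frac\lambda\mu)$, $P_2^A(x)=\sum_{i,j}\frac\mu2\sum_l\max(|(\nabla_lx)_{i,j}|^2,\frac\lambda\mu)$; all are convex. Decomposition $F=f+P_1-P_2$: with $\bullet=I$ for (ITQ) and $\bullet=A$ for (ATQ), either (a) $f(x)=\frac12\|Ax-x_0\|_2^2$, $P_1=P_1^\bullet$, $P_2=P_2^\bullet$; or (b) $f=0$, $P_1(x)=\frac12\|Ax-x_0\|_2^2+P_1^\bullet(x)$, $P_2=P_2^\bullet$. $L\ge0$ is the Lipschitz constant of $\nabla f$ ($L=0$ in case (b)). Metric. $M$ is a self-adjoint linear operator on $X$ with $M\ge L_0\boldsymbol{I}$ (Loewner order), where $L_0>0$ and $L_0\ge L$; $\|x\|_M^2=\langle x,Mx\rangle$. Algorithm preDCA$_e$: take $x^0\in X$, $x^{-1}=x^0$, $\{\beta_t\}\subseteq[0,1)$ with $\sup_t\beta_t<1$; for $t=0,1,\dots$ choose $\xi^t\in\partial P_2(x^t)$ (convex subdifferential), set $y^t=x^t+\beta_t(x^t-x^{t-1})$ and $x^{t+1}=\arg\min_y\{\langle\nabla f(y^t)-\xi^t,y\rangle+\frac12\|y-y^t\|_M^2+P_1(y)\}$.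 $F$ is level-bounded if $\{x:F(x)\le\alpha\}$ is bounded (possibly empty) for every $\alpha\in\mathbb{R}$. *)

(* Defs.v *)
From HB Require Import structures.
From mathcomp Require Import all_boot all_order all_algebra.
From mathcomp Require Import all_classical all_reals all_analysis.

Set Implicit Arguments.
Unset Strict Implicit.
Unset Printing Implicit Defensive.

Import Order.TTheory GRing.Theory Num.Theory.
Import numFieldNormedType.Exports.

Local Open Scope classical_set_scope.
Local Open Scope ring_scope.

Section Euclidean.
Context {R : realType} {m n : nat}.
Local Notation X := 'M[R]_(m, n).

(* The library norm on matrices is the sup norm; the Euclidean structure of
   R^(m x n) ~ R^(mn) is the following one. *)
Definition inner (x y : X) : R := \sum_(i < m) \sum_(j < n) x i j * y i j.

Definition norm2 (x : X) : R := Num.sqrt (inner x x).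

(* The Riesz representative of the differential for [inner]. *)
Definition gradient (f : X -> R) (x : X) : X :=
  \matrix_(i < m, j < n) ('d f x (delta_mx i j)).

Definition euclidean_lipschitz (g : X -> X) (K : R) : Prop :=
  forall x y, norm2 (g x - g y) <= K * norm2 (x - y).

(* "The" Lipschitz constant is the least nonnegative one. *)
Definition lipschitz_constant (g : X -> X) (L : R) : Prop :=
  [/\ 0 <= L, euclidean_lipschitz g L &
      forall K, 0 <= K -> euclidean_lipschitz g K -> L <= K].

Definition subdifferential (P : X -> R) (x : X) : set X :=
  [set xi | forall y, P x + inner xi (y - x) <= P y].

Definition argmin (h : X -> R) : set X := [set x | forall y, h x <= h y].

Definition level_bounded (F : X -> R) : Prop :=
  forall alpha : R, bounded_set [set x | F x <= alpha].

Definition self_adjoint (M : X -> X) : Prop :=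
  forall x y, inner (M x) y = inner x (M y).

Definition loewner_le (M N : X -> X) : Prop :=
  forall x, 0 <= inner x (N x - M x).

Definition normM (M : X -> X) (x : X) : R := Num.sqrt (inner x (M x)).

End Euclidean.

Section TruncatedQuadratic.
Context {R : realType} {m n : nat}.
Local Notation X := 'M[R]_(m, n).

(* [ordS] is the cyclic successor in 'I_m: under the guard it is i + 1. *)
Definition nabla1 (x : X) : X :=
  \matrix_(i < m, j < n) (if (i.+1 < m)%N then x (ordS i) j - x i j else 0).

Definition nabla2 (x : X) : X :=
  \matrix_(i < m, j < n) (if (j.+1 < n)%N then x i (ordS j) - x i j else 0).

(* Component l = 0 is nabla1, component l = 1 is nabla2. *)
Definition nabla (l : 'I_2) (x : X) : X :=
  if val l == 0%N then nabla1 x else nabla2 x.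

Definition nabla_abs (x : X) (i : 'I_m) (j : 'I_n) : R :=
  Num.sqrt (nabla1 x i j ^+ 2 + nabla2 x i j ^+ 2).

Inductive tq_model := ITQ | ATQ.

(* The pixelwise sum with [comb] applied to the squared gradient magnitude and
   the threshold lambda / mu; only [comb] varies among the regularization term
   of F (min), P_1 (sum) and P_2 (max). *)
Definition tq_sum (comb : R -> R -> R) (model : tq_model) (lambda mu : R)
    (x : X) : R :=
  match model with
  | ITQ => \sum_(i < m) \sum_(j < n)
             mu / 2 * comb (nabla_abs x i j ^+ 2) (lambda / mu)
  | ATQ => \sum_(i < m) \sum_(j < n)
             mu / 2 * \sum_(l < 2) comb (`|nabla l x i j| ^+ 2) (lambda / mu)
  end.

Definition tq_P1 := tq_sum +%R.
Definition tq_P2 := tq_sum Num.max.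

Definition data_term {m0 n0 : nat} (A : X -> 'M[R]_(m0, n0))
    (x0 : 'M[R]_(m0, n0)) (x : X) : R :=
  1 / 2 * norm2 (A x - x0) ^+ 2.

Definition tq_F {m0 n0 : nat} (model : tq_model) (A : X -> 'M[R]_(m0, n0))
    (x0 : 'M[R]_(m0, n0)) (lambda mu : R) (x : X) : R :=
  data_term A x0 x + tq_sum Num.min model lambda mu x.

(* The two splittings F = f + P_1 - P_2: the data term is either the smooth
   part f or is absorbed in P_1, in which case f = 0. P_2 is the same. *)
Inductive splitting := DataInF | DataInP1.

Definition split_f {m0 n0 : nat} (s : splitting) (A : X -> 'M[R]_(m0, n0))
    (x0 : 'M[R]_(m0, n0)) : X -> R :=
  match s with
  | DataInF => data_term A x0
  | DataInP1 => fun=> 0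
  end.

Definition split_P1 {m0 n0 : nat} (s : splitting) (model : tq_model)
    (A : X -> 'M[R]_(m0, n0)) (x0 : 'M[R]_(m0, n0)) (lambda mu : R)
    : X -> R :=
  match s with
  | DataInF => tq_P1 model lambda mu
  | DataInP1 => fun x => data_term A x0 x + tq_P1 model lambda mu x
  end.

End TruncatedQuadratic.

Section Algorithm.
Context {R : realType} {m n : nat}.
Local Notation X := 'M[R]_(m, n).

(* Since 0.-1 = 0 on nat, [x t.-1] stands for x^(t-1) with the convention
   x^(-1) = x^0. *)
Definition extrapolate (beta : nat -> R) (x : nat -> X) (t : nat) : X :=
  x t + beta t *: (x t - x t.-1).

Definition preDCAe_sequence (f P1 P2 : X -> R) (M : X -> X)
    (beta : nat -> R) (x : nat -> X) : Prop :=
  exists xi : nat -> X, forall t : nat,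
    subdifferential P2 (x t) (xi t) /\
    let yt := extrapolate beta x t in
    argmin (fun y => inner (gradient f yt - xi t) y
                     + 1 / 2 * normM M (y - yt) ^+ 2 + P1 y) (x t.+1).

Definition energy (F : X -> R) (M : X -> X) (z : X * X) : R :=
  F z.1 + 1 / 2 * normM M (z.1 - z.2) ^+ 2.

Definition pair_sequence (x : nat -> X) (t : nat) : X * X := (x t, x t.-1).

Definition accumulation_points {T : topologicalType} (u : nat -> T) : set T :=
  cluster (u @ \oo).

End Algorithm.

(* Main.v *)
(* The proximal objective defining x^(t+1) is 1-strongly convex for |.|_M, so
   comparing its values at x^(t+1) and x^t, bounding P_2 from below by its
   subgradient and f by its convexity and the quadratic upper bound at y^t
   (valid since L <= L0 and M >= L0), one gets
     E(x^(t+1), x^t) + (1 - beta_t^2) / 2 * |x^t - x^(t-1)|_M^2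
       <= E(x^t, x^(t-1)).
   As E >= 0 and sup beta_t < 1, the energies converge and the increments tend
   to 0; E being continuous, it takes the limit value at accumulation points. *)

Require Import Defs.
From HB Require Import structures.
From mathcomp Require Import all_boot all_order all_algebra ring lra.
From mathcomp Require Import all_classical all_reals all_analysis.

Import Order.TTheory GRing.Theory Num.Theory.
Import numFieldNormedType.Exports.

Local Open Scope classical_set_scope.
Local Open Scope ring_scope.

(** * Euclidean inner product and the Cauchy-Schwarz inequality *)

Section Inner.
Context {R : realType} {m n : nat}.
Implicit Types (x y z : 'M[R]_(m, n)) (c : R).

Lemma innerC x y : inner x y = inner y x.
Proof. by apply: eq_bigr => i _; apply: eq_bigr => j _; rewrite mulrC. Qed.

Lemma innerDl x y z : inner (x + y) z = inner x z + inner y z.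
Proof.
rewrite /inner -big_split; apply: eq_bigr => i _; rewrite -big_split.
by apply: eq_bigr => j _; rewrite mxE mulrDl.
Qed.

Lemma innerZl c x y : inner (c *: x) y = c * inner x y.
Proof.
rewrite /inner big_distrr; apply: eq_bigr => i _; rewrite big_distrr.
by apply: eq_bigr => j _; rewrite mxE /= mulrA.
Qed.

Lemma innerNl x y : inner (- x) y = - inner x y.
Proof. by rewrite -scaleN1r innerZl mulN1r. Qed.

Lemma innerBl x y z : inner (x - y) z = inner x z - inner y z.
Proof. by rewrite innerDl innerNl. Qed.

Lemma innerDr x y z : inner z (x + y) = inner z x + inner z y.
Proof. by rewrite innerC innerDl !(innerC z). Qed.

Lemma innerZr c x y : inner y (c *: x) = c * inner y x.
Proof. by rewrite innerC innerZl (innerC y). Qed.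

Lemma innerNr x y : inner y (- x) = - inner y x.
Proof. by rewrite innerC innerNl (innerC y). Qed.

Lemma inner0l y : inner 0 y = 0.
Proof. by rewrite -(scale0r 0) innerZl mul0r. Qed.

Definition innerE :=
  (innerDl, innerDr, innerNl, innerNr, innerZl, innerZr).

Lemma inner_ge0 x : 0 <= inner x x.
Proof. by apply: sumr_ge0 => i _; apply: sumr_ge0 => j _; rewrite sqr_ge0. Qed.

Lemma sqr_norm2 x : norm2 x ^+ 2 = inner x x.
Proof. by rewrite sqr_sqrtr // inner_ge0. Qed.

Lemma norm2_ge0 x : 0 <= norm2 x.
Proof. exact: sqrtr_ge0. Qed.

(** Cauchy-Schwarz: expand the square of <y,y> x - <x,y> y, the case <y,y> = 0 being treated
    apart. *)
Lemma inner_le_norm2 x y : inner x y <= norm2 x * norm2 y.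
Proof.
have [a0 b0] := (norm2_ge0 x, norm2_ge0 y).
have [y0|yn0] := eqVneq (inner y y) 0.
  (* When <y,y> = 0 the nonnegative square is affine in [c], so its slope [inner x y] has to
     vanish. *)
  have h c : 0 <= inner x x + c * inner x y.
    have := inner_ge0 (x + (c / 2) *: y).
    by rewrite !innerE y0 (innerC y x); lra.
  have [-> |xy] := eqVneq (inner x y) 0; first by rewrite mulr_ge0.
  (* This [c] would give the affine function the value -1. *)
  have := h (- (inner x x + 1) / inner x y).
  by rewrite divfK //; lra.
have yp : 0 < inner y y by rewrite lt_def yn0 inner_ge0.
have := inner_ge0 (inner y y *: x - inner x y *: y).
rewrite !innerE (innerC y x) => h.
rewrite (le_trans (ler_norm _)) // -ler_sqr ?nnegrE ?mulr_ge0 //.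
rewrite real_normK ?num_real // exprMn !sqr_norm2 -(ler_pM2l yp); nra.
Qed.

End Inner.

(** * The squared M-norm and the proximal step *)

Section Quadratic.
Context {R : realType} {m n : nat}.
Variables (M : {linear 'M[R]_(m, n) -> 'M[R]_(m, n)}).
Hypotheses (M_self_adjoint : self_adjoint M)
  (M_ge0 : forall v, 0 <= inner v (M v)).
Implicit Types (u v : 'M[R]_(m, n)) (c : R).

Lemma sqr_normM v : normM M v ^+ 2 = inner v (M v).
Proof. by rewrite sqr_sqrtr. Qed.

Lemma sqr_normMDZ u c v : normM M (u + c *: v) ^+ 2 =
  normM M u ^+ 2 + 2 * c * inner u (M v) + c ^+ 2 * normM M v ^+ 2.
Proof.
rewrite !sqr_normM linearD linearZ !innerE (innerC v) M_self_adjoint; ring.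
Qed.

Lemma sqr_normMZ c v : normM M (c *: v) ^+ 2 = c ^+ 2 * normM M v ^+ 2.
Proof. rewrite !sqr_normM linearZ !innerE; ring. Qed.

Lemma sqr_normMB u v : normM M (u - v) ^+ 2 = normM M (v - u) ^+ 2.
Proof. by rewrite -opprB -scaleN1r sqr_normMZ sqrrN expr1n mul1r. Qed.

Definition segment_convex (P : 'M[R]_(m, n) -> R) := forall p q s,
  0 <= s <= 1 -> P (p + s *: (q - p)) <= (1 - s) * P p + s * P q.

(** Strong convexity of the proximal objective: minimality of [p] against [p + s *: (q - p)],
    divided by [s], gives (1 - s) D <= h q - h p for 0 < s < 1. Letting s tend to 0 is replaced by
    one well-chosen [s]. *)
Lemma argmin_prox_le (P : 'M[R]_(m, n) -> R) g y p q :
  segment_convex P ->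
  let h z := inner g z + 1 / 2 * normM M (z - y) ^+ 2 + P z in
  argmin h p -> h p + 1 / 2 * normM M (q - p) ^+ 2 <= h q.
Proof.
move=> Pcvx h hp; set D := 1 / 2 * _.
have D0 : 0 <= D by rewrite mulr_ge0 // sqr_ge0.
have hs s : 0 < s < 1 -> (1 - s) * D <= h q - h p.
  case/andP=> s0 s1; have := hp (p + s *: (q - p)).
  have := Pcvx p q s; rewrite (ltW s0) (ltW s1) => /(_ isT).
  (* [q - y] gets the same base [p - y] and direction [q - p] as the intermediate point, so that
     [sqr_normMDZ] expands both. *)
  rewrite /h; have -> : q - y = (p - y) + 1 *: (q - p).
    by rewrite scale1r [RHS]addrC addrA subrK.
  rewrite (addrAC p) !sqr_normMDZ !innerE -/D => Ps hps.
  rewrite -(ler_pM2l s0); move: Ps hps; rewrite /D; lra.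
have K0 : h p <= h q := hp q.
rewrite addrC -lerBrDr leNgt; apply/negP; set K := h q - h p in hs * => DK.
have K_ge0 : 0 <= K by rewrite subr_ge0.
(* If K < D, this [s] turns (1 - s) D into the midpoint of D and K, which exceeds K. *)
have := hs ((D - K) / (2 * D)).
have -> : (1 - (D - K) / (2 * D)) * D = (D + K) / 2.
  by field; rewrite gt_eqF //; lra.
rewrite divr_gt0 ?ltr_pdivrMr; lra.
Qed.

(** Here [p] is the new iterate, [q] the current one and [y] the extrapolated point. The two bounds
    on [f], the subgradient inequality at [q] tested at [p], and the proximal inequality are added;
    the linear terms and the M-norm of [p - y] cancel. *)
Lemma dca_step (f P1 P2 : 'M[R]_(m, n) -> R) g xi p q y :
  f p <= f y + inner g (p - y) + 1 / 2 * normM M (p - y) ^+ 2 ->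
  f y + inner g (q - y) <= f q ->
  segment_convex P1 -> subdifferential P2 q xi ->
  argmin (fun z => inner (g - xi) z + 1 / 2 * normM M (z - y) ^+ 2 + P1 z) p ->
  f p + P1 p - P2 p + 1 / 2 * normM M (p - q) ^+ 2 <=
  f q + P1 q - P2 q + 1 / 2 * normM M (q - y) ^+ 2.
Proof.
move=> fp fq P1cvx /(_ p) xiq /(argmin_prox_le _ _ _ _ q P1cvx) /= hp.
by move: fp fq xiq hp; rewrite (sqr_normMB p q) !innerE; lra.
Qed.

End Quadratic.

(** * Continuity and differentiability of finite sums and linear maps *)

Section ContinuousMatrix.
Context {R : realType}.

Lemma continuous_bigsum {T : topologicalType} (I : Type) (r : seq I)
    (F : I -> T -> R) :
  (forall i, continuous (F i)) -> continuous (fun x => \sum_(i <- r) F i x).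
Proof. by move=> ?; apply: continuous_big => //; exact: add_continuous. Qed.

Lemma continuous_mull {T : topologicalType} (a : R) (F : T -> R) :
  continuous F -> continuous (fun x => a * F x).
Proof. by move=> cF x; apply: cvgMl_tmp; exact: cF. Qed.

Lemma continuous_addr {T : topologicalType} (F G : T -> R) :
  continuous F -> continuous G -> continuous (fun x => F x + G x).
Proof. by move=> cF cG x; apply: cvgD; [exact: cF|exact: cG]. Qed.

Lemma continuous_minr {T : topologicalType} (F G : T -> R) :
  continuous F -> continuous G -> continuous (fun x => Num.min (F x) (G x)).
Proof. by move=> cF cG x; apply: continuous_min; [exact: cF|exact: cG]. Qed.

Lemma differentiable_bigsum {V : normedModType R} (I : Type) (r : seq I)
    (F : I -> V -> R) y :
  (forall i, differentiable (F i) y) ->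
  differentiable (fun x => \sum_(i <- r) F i x) y.
Proof.
move=> dF; rewrite -fct_sumE; elim/big_ind : _ => // *.
exact: differentiableD.
Qed.

(** In finite dimension [A x] is a sum of coordinates of [x], which are continuous, times fixed
    vectors. *)
Lemma linear_mx_continuous {m n} {W : normedModType R}
  (A : {linear 'M[R]_(m, n) -> W}) : continuous A.
Proof.
rewrite (_ : (A : _ -> _) =
    fun x => \sum_(i < m) \sum_(j < n) x i j *: A (delta_mx i j)); last first.
  apply/funext => x; rewrite {1}(matrix_sum_delta x) linear_sum.
  apply: eq_bigr => i _; rewrite linear_sum.
  by apply: eq_bigr => j _; rewrite linearZ.
apply: continuous_big => [|i _]; first exact: add_continuous.
apply: continuous_big => [|j _]; first exact: add_continuous.
move=> x; apply: cvgZr_tmp; [exact: nbhs_filter|exact: coord_continuous].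
Qed.

End ContinuousMatrix.

(** * Differential calculus of the least-squares term *)

Section DataTerm.
Context {R : realType} {m n m0 n0 : nat}.
Variables (A : {linear 'M[R]_(m, n) -> 'M[R]_(m0, n0)}) (x0 : 'M[R]_(m0, n0)).
Implicit Types (v x y : 'M[R]_(m, n)).

(** The differential, the exact Taylor formula and the convexity of the data term are all read off
    from this expansion. *)
Lemma data_termDZ y (c : R) v : data_term A x0 (y + c *: v) =
  data_term A x0 y + c * inner (A y - x0) (A v) +
  c ^+ 2 * (1 / 2 * inner (A v) (A v)).
Proof.
rewrite /data_term !sqr_norm2 linearD linearZ /= !innerE.
rewrite (innerC (A v) (A y)) (innerC (A v) x0) (innerC x0 (A y)). lra.
Qed.

Lemma data_term_differentiable y : differentiable (data_term A x0) y.
Proof.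
have -> : data_term A x0 = fun x => 1 / 2 *
    \sum_(i < m0) \sum_(j < n0) (A x i j - x0 i j) * (A x i j - x0 i j).
  apply/funext => x; rewrite /data_term sqr_norm2; congr (_ * _).
  by apply: eq_bigr => i _; apply: eq_bigr => j _; rewrite !mxE.
apply: differentiableM => //.
apply: differentiable_bigsum => i; apply: differentiable_bigsum => j.
have dA : differentiable (fun x => A x i j - x0 i j) y;
  last exact: differentiableM.
apply: differentiableB => //.
apply: (@differentiable_comp _ _ _ _ A (fun z : 'M[R]_(m0, n0) => z i j)).
  exact/linear_differentiable/linear_mx_continuous.
exact: differentiable_coord.
Qed.

Lemma data_term_continuous : continuous (data_term A x0).
Proof.
by move=> y; apply: differentiable_continuous; exact: data_term_differentiable.
Qed.

(** The differential is computed as a directional derivative: by [data_termDZ] the difference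
    quotient is exactly l + h q for h != 0. *)
Lemma diff_data_term y v : 'd (data_term A x0) y v = inner (A y - x0) (A v).
Proof.
rewrite -deriveE; last exact: data_term_differentiable.
set l := inner _ _; set q := 1 / 2 * inner (A v) (A v).
have quot_cvg : (fun h : R => l + h * q) @ 0^' --> l + 0 * q.
  apply: cvgD; first exact: cvg_cst.
  by apply: cvgMr_tmp; exact: cvg_within.
rewrite mul0r addr0 in quot_cvg.
apply/cvg_lim => //=; apply: cvg_trans quot_cvg.
apply: near_eq_cvg; near=> h.
have h0 : h != 0 by near: h; exact: nbhs_dnbhs_neq.
rewrite [h *: v + y]addrC data_termDZ -/l -/q.
by rewrite [X in _ = X]mulrDr; field.
Unshelve. all: by end_near. Qed.

(** By linearity of the differential, its values on the basis [delta_mx i j] determine it; the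
    gradient is thus A^T (A y - x0), without a transpose having to be introduced. *)
Lemma inner_gradient_data y v :
  inner (gradient (data_term A x0) y) v = inner (A y - x0) (A v).
Proof.
rewrite -diff_data_term {2}(matrix_sum_delta v) linear_sum.
apply: eq_bigr => i _; rewrite linear_sum; apply: eq_bigr => j _.
by rewrite linearZ !mxE mulrC.
Qed.

(** The remainder is explicit: its sign gives the linear lower bound on f, and its size the
    quadratic upper bound. *)
Lemma data_term_gradient y x : data_term A x0 x = data_term A x0 y +
  inner (gradient (data_term A x0) y) (x - y) +
  1 / 2 * inner (A (x - y)) (A (x - y)).
Proof.
have {1}-> : x = y + 1 *: (x - y) by rewrite scale1r addrC subrK.
by rewrite data_termDZ inner_gradient_data mul1r expr1n mul1r.
Qed.

(* |A v|^2 = <A^T A v, v>, where A^T A is the linear part of the gradient. *)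
Lemma sqr_linear_le_lipschitz L v :
  euclidean_lipschitz (gradient (data_term A x0)) L ->
  inner (A v) (A v) <= L * inner v v.
Proof.
move=> /(_ v 0); rewrite subr0 => lip.
have -> : inner (A v) (A v) =
    inner (gradient (data_term A x0) v - gradient (data_term A x0) 0) v.
  rewrite innerBl [X in _ = X - _]inner_gradient_data.
  rewrite [X in _ = _ - X]inner_gradient_data (linear0 A).
  by rewrite -innerBl sub0r opprK subrK.
rewrite (le_trans (inner_le_norm2 _ _)) // -sqr_norm2 expr2 mulrA.
by rewrite ler_wpM2r // norm2_ge0.
Qed.

End DataTerm.

(** * Stability of convexity, and convexity of the data term *)

Section Convexity.
Context {R : realType} {m n : nat}.
Local Notation X := 'M[R]_(m, n).

Lemma segment_convexD (P Q : X -> R) : segment_convex P -> segment_convex Q ->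
  segment_convex (fun x => P x + Q x).
Proof.
by move=> hP hQ p q s s01; have := lerD (hP p q s s01) (hQ p q s s01); lra.
Qed.

Lemma segment_convexZ (a : R) (P : X -> R) : 0 <= a -> segment_convex P ->
  segment_convex (fun x => a * P x).
Proof.
move=> a0 hP p q s s01; rewrite (le_trans (ler_wpM2l a0 (hP p q s s01))) //.
by lra.
Qed.

Lemma segment_convex_cst (a : R) : segment_convex (fun _ : X => a).
Proof. by move=> p q s s01; lra. Qed.

Lemma segment_convex_sum (I : Type) (r : seq I) (P : I -> X -> R) :
  (forall i, segment_convex (P i)) ->
  segment_convex (fun x => \sum_(i <- r) P i x).
Proof.
move=> hP p q s s01; rewrite !big_distrr -big_split; apply: ler_sum => i _.
exact: hP.
Qed.

Lemma data_term_convex {m0 n0} (A : {linear X -> 'M[R]_(m0, n0)}) x0 :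
  segment_convex (data_term A x0).
Proof.
move=> p q s /andP[s0 s1]; have := data_termDZ A x0 p 1 (q - p).
rewrite scale1r addrC subrK data_termDZ => ->.
(* Half of this quantity is the gap in the convexity inequality. *)
have : 0 <= (s * (1 - s)) * inner (A (q - p)) (A (q - p)).
  by rewrite !mulr_ge0 ?inner_ge0 // subr_ge0.
lra.
Qed.

End Convexity.

(** * The truncated quadratic regularizer and its convex parts *)

Section TruncatedQuadratic.
Context {R : realType} {m n : nat}.
Implicit Types (x p q : 'M[R]_(m, n)) (comb : R -> R -> R).

Lemma nablaDZ l p q (s : R) i j : nabla l (p + s *: (q - p)) i j =
  nabla l p i j + s * (nabla l q i j - nabla l p i j).
Proof.
by rewrite /nabla; case: ifP => _; rewrite !mxE; case: ifP => _; lra.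
Qed.

Lemma sqr_nabla_convex l i j :
  segment_convex (fun x => nabla l x i j ^+ 2).
Proof.
move=> p q s /andP[s0 s1]; rewrite nablaDZ.
set a := nabla l p i j; set b := nabla l q i j.
rewrite -subr_ge0 (_ : _ - _ = s * (1 - s) * (b - a) ^+ 2); last by ring.
by rewrite mulr_ge0 ?sqr_ge0 // mulr_ge0 // subr_ge0.
Qed.

Lemma nabla_continuous l i j : continuous (fun x => nabla l x i j).
Proof.
have dcont i1 j1 i2 j2 : continuous (fun x => x i1 j1 - x i2 j2).
  by move=> x; apply: cvgB; [exact: nbhs_filter|exact: coord_continuous..].
have -> : (fun x => nabla l x i j) = fun x =>
    if val l == 0%N then if (i.+1 < m)%N then x (ordS i) j - x i j else 0
    else if (j.+1 < n)%N then x i (ordS j) - x i j else 0.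
  by apply/funext => x; rewrite /nabla; case: ifP => _; rewrite mxE.
case: (val l == 0%N); [case: (i.+1 < m)%N|case: (j.+1 < n)%N].
- exact: dcont.
- exact: cst_continuous.
- exact: dcont.
- exact: cst_continuous.
Qed.

(* The pixelwise squared magnitudes to which [comb] is applied in [tq_sum],
   indexed by [option 'I_2]: [None] is the isotropic one. *)
Definition sqr_grad (k : option 'I_2) i j x : R :=
  if k is Some l then nabla l x i j ^+ 2
  else nabla ord0 x i j ^+ 2 + nabla ord_max x i j ^+ 2.

(** Puts both models in one form, a sum over a list of indices [k], so that sign, convexity and
    continuity are proved once for both. *)
Lemma tq_sumE comb model lambda mu : tq_sum comb model lambda mu = fun x =>
  \sum_(i < m) \sum_(j < n) mu / 2 *
    \sum_(k <- if model is ITQ then [:: None]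
               else [seq Some l | l <- enum 'I_2])
      comb (sqr_grad k i j x) (lambda / mu).
Proof.
apply/funext => x; case: model; apply: eq_bigr => i _;
  apply: eq_bigr => j _; congr (_ * _).
  by rewrite big_seq1 sqr_sqrtr // addr_ge0 ?sqr_ge0.
rewrite big_map big_enum; apply: eq_bigr => l _.
by rewrite real_normK ?num_real.
Qed.

Lemma sqr_grad_ge0 k i j x : 0 <= sqr_grad k i j x.
Proof. by case: k => [l|] /=; rewrite ?addr_ge0 ?sqr_ge0. Qed.

Lemma sqr_grad_convex k i j : segment_convex (sqr_grad k i j).
Proof.
case: k => [l|]; first exact: sqr_nabla_convex.
by apply: segment_convexD; exact: sqr_nabla_convex.
Qed.

Lemma sqr_grad_continuous k i j : continuous (sqr_grad k i j).
Proof.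
have sq l : continuous (fun x => nabla l x i j ^+ 2).
  by move=> x; apply: cvgM; [exact: nbhs_filter|exact: nabla_continuous..].
case: k => [l|]; first exact: sq.
by move=> x; apply: cvgD; [exact: nbhs_filter|exact: sq..].
Qed.

Variables (model : tq_model) (lambda mu : R).
Hypotheses (lambda_gt0 : 0 < lambda) (mu_gt0 : 0 < mu).

(** Termwise, min(a, b) = a + b - max(a, b). *)
Lemma tq_minE x : tq_sum Num.min model lambda mu x =
  tq_P1 model lambda mu x - tq_P2 model lambda mu x.
Proof.
rewrite /tq_P1 /tq_P2 !tq_sumE -sumrB; apply: eq_bigr => i _.
rewrite -sumrB; apply: eq_bigr => j _; rewrite -mulrBr -sumrB.
by congr (_ * _); apply: eq_bigr => k _; rewrite minr_to_max.
Qed.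

Lemma tq_min_ge0 x : 0 <= tq_sum Num.min model lambda mu x.
Proof.
rewrite tq_sumE; apply: sumr_ge0 => i _; apply: sumr_ge0 => j _.
apply: mulr_ge0; first by rewrite divr_ge0 // ltW.
apply: sumr_ge0 => k _.
by rewrite le_min sqr_grad_ge0 divr_ge0 // ltW.
Qed.

Lemma tq_P1_convex : segment_convex (@tq_P1 R m n model lambda mu).
Proof.
rewrite /tq_P1 tq_sumE.
apply: segment_convex_sum => i; apply: segment_convex_sum => j.
apply: segment_convexZ; first by rewrite divr_ge0 // ltW.
apply: segment_convex_sum => k; apply: segment_convexD.
  exact: sqr_grad_convex.
exact: segment_convex_cst.
Qed.

Lemma tq_min_continuous : continuous (@tq_sum R m n Num.min model lambda mu).
Proof.
rewrite tq_sumE.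
apply: continuous_bigsum => i; apply: continuous_bigsum => j.
apply: continuous_mull; apply: continuous_bigsum => k.
apply: continuous_minr; last exact: cst_continuous.
exact: sqr_grad_continuous.
Qed.

End TruncatedQuadratic.

(** * Bounds on the smooth part, and descent of the energy *)

Section Energy.
Context {R : realType} {m n m0 n0 : nat}.
Local Notation X := 'M[R]_(m, n).
Variables (A : {linear X -> 'M[R]_(m0, n0)}) (x0 : 'M[R]_(m0, n0)).
Variables (model : tq_model) (s : splitting) (lambda mu : R).
Hypotheses (lambda_gt0 : 0 < lambda) (mu_gt0 : 0 < mu).
Variables (M : {linear X -> X}).
Hypotheses (M_self_adjoint : self_adjoint M)
  (M_ge0 : forall v, 0 <= inner v (M v)).

Local Notation F := (tq_F model A x0 lambda mu).
Local Notation f := (split_f s A x0).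
Local Notation P1 := (split_P1 s model A x0 lambda mu).
Local Notation P2 := (tq_P2 model lambda mu).

Lemma tq_F_split x : F x = f x + P1 x - P2 x.
Proof. by rewrite /tq_F tq_minE; case: s => /=; lra. Qed.

Lemma tq_F_ge0 x : 0 <= F x.
Proof.
by rewrite addr_ge0 ?tq_min_ge0 // mulr_ge0 ?sqr_ge0.
Qed.

Lemma split_P1_convex : segment_convex P1.
Proof.
case: s => /=; first exact: tq_P1_convex.
by apply: segment_convexD; [exact: data_term_convex|exact: tq_P1_convex].
Qed.

Lemma gradient_cst (a : R) (x : X) : gradient (fun=> a) x = 0.
Proof. by apply/matrixP => i j; rewrite !mxE diff_cst. Qed.

Lemma split_f_ge_linear x y : f y + inner (gradient f y) (x - y) <= f x.
Proof.
case: s => /=; last by rewrite gradient_cst inner0l addr0.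
by rewrite (data_term_gradient A x0 y x) lerDl mulr_ge0 // inner_ge0.
Qed.

(** For the data term, the Taylor remainder |A(x - y)|^2 / 2 is at most L |x - y|^2 / 2, and M
    dominates L I. For f = 0 it is nonnegativity of M. *)
Lemma split_f_le_quadratic L x y : lipschitz_constant (gradient f) L ->
  loewner_le (fun x => L *: x) M ->
  f x <= f y + inner (gradient f y) (x - y) + 1 / 2 * normM M (x - y) ^+ 2.
Proof.
rewrite sqr_normM //; case: s => /= [[_ lip _]|_] LM; last first.
  by rewrite gradient_cst inner0l !add0r mulr_ge0.
rewrite (data_term_gradient A x0 y x) lerD2l ler_wpM2l //.
rewrite (le_trans (sqr_linear_le_lipschitz _ _ _ _ lip)) //.
by rewrite -innerZr -subr_ge0 -innerNr -innerDr LM.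
Qed.

Lemma sqr_normM_continuous : continuous (fun v => normM M v ^+ 2).
Proof.
rewrite (_ : (fun v => _) = fun v => inner v (M v)); last first.
  by apply/funext => v; rewrite sqr_normM.
apply: continuous_bigsum => i; apply: continuous_bigsum => j v.
apply: cvgM; [exact: nbhs_filter|exact: coord_continuous|].
apply: (@continuous_comp _ _ _ M (fun z : X => z i j)).
  exact: linear_mx_continuous.
exact: coord_continuous.
Qed.

Lemma energy_continuous : continuous (energy F M).
Proof.
have cF : continuous F.
  apply: continuous_addr; last exact: tq_min_continuous.
  exact: data_term_continuous.
apply: continuous_addr => [z|].
  by apply: (@continuous_comp _ _ _ fst F); [exact: cvg_fst|exact: cF].
apply: continuous_mull => z.
apply: (@continuous_comp _ _ _ (fun z : X * X => z.1 - z.2)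
  (fun v => normM M v ^+ 2)); last exact: sqr_normM_continuous.
by apply: cvgB; [exact: cvg_fst|exact: cvg_snd].
Qed.

Lemma energy_ge0 z : 0 <= energy F M z.
Proof. by rewrite addr_ge0 ?tq_F_ge0 // mulr_ge0 ?sqr_ge0. Qed.

(** [dca_step] at x^(t+1), x^t and y^t. Since x^t - y^t = -beta_t (x^t - x^(t-1)), extrapolation
    costs at most b^2 / 2 times the squared increment, out of the 1 / 2 present in the energy. The
    bound [b] makes the gain uniform in [t]. *)
Lemma energy_descent L (beta : nat -> R) b (x : nat -> X) t :
  lipschitz_constant (gradient f) L -> loewner_le (fun x => L *: x) M ->
  0 <= beta t <= b ->
  preDCAe_sequence f P1 P2 M beta x ->
  energy F M (pair_sequence x t.+1) +
    (1 - b ^+ 2) / 2 * normM M (x t - x t.-1) ^+ 2 <=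
  energy F M (pair_sequence x t).
Proof.
move=> lip LM /andP[b0 bb] [xi /(_ t)[xit argt]].
have := dca_step M M_self_adjoint M_ge0 _ _ _ _ _ _ _ _
  (split_f_le_quadratic L (x t.+1) (extrapolate beta x t) lip LM)
  (split_f_ge_linear (x t) _) split_P1_convex xit argt.
rewrite -!tq_F_split /energy /=.
rewrite [x t - extrapolate _ _ _](_ : _ = (- beta t) *: (x t - x t.-1)); last first.
  by rewrite /extrapolate opprD addrA subrr add0r scaleNr.
rewrite sqr_normMZ // sqrrN.
have : beta t ^+ 2 <= b ^+ 2 by rewrite ler_sqr ?nnegrE // (le_trans b0).
by move=> /(ler_wpM2r (sqr_ge0 (normM M (x t - x t.-1)))); lra.
Qed.

End Energy.

(** * Passage to the limit *)

(** A cluster point is the limit of a proper filter [G] finer than the sequence; along [G], [E]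
    tends both to [E z] and to [l], and limits are unique. *)
Lemma cluster_cvg_continuous {T : topologicalType} {R : realType}
    (E : T -> R) (u : nat -> T) (l : R) z :
  continuous E -> (fun t => E (u t)) @ \oo --> l ->
  accumulation_points u z -> E z = l.
Proof.
move=> Econt Eul; rewrite /accumulation_points cluster_cvgE.
move=> [G GP [Gz uG]].
have EGz : E @ G --> E z by apply: cvg_trans (Econt z); exact: cvg_fmap2.
have EGl : E @ G --> l by apply: cvg_trans Eul => P; exact: uG.
exact: (cvg_unique _ EGz EGl).
Qed.

Theorem theorem2 (R : realType) (m n m0 n0 : nat)
  (lambda mu : R) (lambda_gt0 : 0 < lambda) (mu_gt0 : 0 < mu)
  (A : {linear 'M[R]_(m, n) -> 'M[R]_(m0, n0)}) (x0 : 'M[R]_(m0, n0))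
  (model : tq_model) (s : splitting)
  (F_level_bounded : level_bounded (tq_F model A x0 lambda mu))
  (L : R) (L_lipschitz : lipschitz_constant (gradient (split_f s A x0)) L)
  (L0 : R) (L0_gt0 : 0 < L0) (L_le_L0 : L <= L0)
  (M : {linear 'M[R]_(m, n) -> 'M[R]_(m, n)})
  (M_self_adjoint : self_adjoint M)
  (M_ge_L0 : loewner_le (fun x => L0 *: x) M)
  (beta : nat -> R) (beta_itv : forall t, 0 <= beta t < 1)
  (beta_sup : sup (range beta) < 1)
  (x : nat -> 'M[R]_(m, n))
  (x_preDCAe : preDCAe_sequence (split_f s A x0)
     (split_P1 s model A x0 lambda mu) (tq_P2 model lambda mu) M beta x) :
  (fun t => normM M (x t.+1 - x t)) @ \oo --> (0 : R) /\
  exists zeta : R,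
    (fun t => energy (tq_F model A x0 lambda mu) M (pair_sequence x t)) @ \oo
      --> zeta /\
    forall z, accumulation_points (pair_sequence x) z ->
      energy (tq_F model A x0 lambda mu) M z = zeta.
Proof.
have M_ge v : L0 * inner v v <= inner v (M v).
  by rewrite -innerZr -subr_ge0 -innerNr -innerDr; exact: M_ge_L0.
have M_ge0 v : 0 <= inner v (M v).
  by rewrite (le_trans _ (M_ge v)) // mulr_ge0 ?inner_ge0 // ltW.
have LM : loewner_le (fun x => L *: x) M.
  move=> v; rewrite innerDr innerNr innerZr subr_ge0 (le_trans _ (M_ge v)) //.
  by rewrite ler_wpM2r ?inner_ge0.
set b := sup (range beta) in beta_sup.
have beta_b t : 0 <= beta t <= b.
  case/andP: (beta_itv t) => -> _ /=; apply: ub_le_sup; last by exists t.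
  (* [sup] is an upper bound only for a set that is bounded above; here 1 bounds the range. *)
  by exists 1 => _ [k _ <-]; case/andP: (beta_itv k) => _ /ltW.
have b0 : 0 <= b by case/andP: (beta_b 0%N) => h1 h2; exact: le_trans h2.
set E := energy _ _; set c := (1 - b ^+ 2) / 2.
have c_gt0 : 0 < c.
  by rewrite divr_gt0 // subr_gt0 expr_lt1.
have step t : E (pair_sequence x t.+1) + c * normM M (x t - x t.-1) ^+ 2 <=
    E (pair_sequence x t).
  by apply: energy_descent L_lipschitz LM (beta_b t) x_preDCAe.
(* The energies are nonincreasing and bounded below by 0, so they converge to their infimum. *)
set zeta := inf (range (fun t => E (pair_sequence x t))).
have E_cvg : (fun t => E (pair_sequence x t)) @ \oo --> zeta.
  apply: nonincreasing_cvgn.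
    apply/nonincreasing_seqP => t; apply: le_trans (step t).
    by rewrite lerDl mulr_ge0 ?sqr_ge0 // ltW.
  by exists 0 => _ [t _ <-]; exact: energy_ge0.
split; last first.
  exists zeta; split => // z.
  by apply: cluster_cvg_continuous E_cvg; exact: energy_continuous.
have sqr_cvg0 : (fun t => normM M (x t.+1 - x t) ^+ 2) @ \oo --> (0 : R).
  (* The squared increment lies between 0 and c^-1 times an energy drop. The indices are shifted by
     one because the descent at [t] controls x^t - x^(t-1). *)
  apply: (@squeeze_cvgr _ _ _ _ (fun=> 0) (fun t => c^-1 *
    (E (pair_sequence x t.+1) - E (pair_sequence x t.+2)))).
  - apply: nearW => t; rewrite sqr_ge0 /= ler_pdivlMl //.
    by rewrite lerBrDl; exact: (step t.+1).
  - exact: cvg_cst.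
  (* Both shifted energy sequences tend to [zeta], so the drops tend to zeta - zeta = 0. *)
  - rewrite -(mulr0 c^-1) -(subrr zeta).
    apply: cvgMl_tmp; apply: cvgB.
      by move: E_cvg; rewrite -(cvg_shiftn 1); under eq_fun do rewrite addn1.
    by move: E_cvg; rewrite -(cvg_shiftn 2); under eq_fun do rewrite addn2.
(* The norms are recovered from their squares by continuity of the square root. *)
rewrite (_ : (fun t => _) =
    Num.sqrt \o (fun t => normM M (x t.+1 - x t) ^+ 2)); last first.
  by apply/funext => t /=; rewrite sqrtr_sqr ger0_norm ?sqrtr_ge0.
rewrite -(sqrtr0 R); apply: continuous_cvg; last exact: sqr_cvg0.
exact: sqrt_continuous.
Qed.
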